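(* Let $H$ be a Hilbert space over $\mathbb{R}$ or $\mathbb{C}$, let $[a,b]$ be a compact real interval, and let $\Delta := \{(t,s)\in\mathbb{R}^2 : a\le t\le s\le b\}$. Let $f\in L([a,b];H)$ be such that there exist real numbers $M\ge 1\ge m> 0$ such that either $$\operatorname{Re}\langle Mf(s)-f(t),\, f(t)-mf(s)\rangle \ge 0\quad\text{for a.e. }(t,s)\in\Delta,$$ or, equivalently, $$\left\|f(t)-\frac{M+m}{2}f(s)\right\| \le \frac12 (M-m)\|f(s)\|\quad\text{for a.e. }(t,s)\in\Delta.$$ Then $$\left(\int_a^b\|f(t)\|\,dt\right)^2 - \left\|\int_a^b f(t)\,dt\right\|^2 \le \frac{(\sqrt M-\sqrt m)^2}{2\sqrt{Mm}}\left\|\int_a^b f(t)\,dt\right\|^2, \qquad ( * )$$ or, equivalently, $$\int_a^b\|f(t)\|\,dt \le \left(\frac{M+m}{2\sqrt{Mm}}\right)^{1/2}\left\|\int_a^b f(t)\,dt\right\|. \qquad ( ** )$$ Equality holds in $( * )$ or $( ** )$ if and only if $$\|f(t)\|\,\|f(s)\| = \frac{M+m}{2\sqrt{Mm}}\operatorname{Re}\langle f(t),f(s)\rangle\quad\text{for a.e. }(t,s)\in\Delta.$$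
   Context: $L([a,b];H)$ denotes the space of Bochner integrable functions on $[a,b]$ (with Lebesgue measure) with values in the Hilbert space $H$. $\langle\cdot,\cdot\rangle$ is the inner product of $H$ and $\|\cdot\|$ its norm. ''For a.e. $(t,s)\in\Delta$'' refers to two-dimensional Lebesgue measure. *)

(* Defs.v *)
From HB Require Import structures.
From mathcomp Require Import all_boot all_order all_algebra.
From mathcomp Require Import sesquilinear complex.
From mathcomp Require Import all_classical all_reals all_analysis.
Import Order.TTheory GRing.Theory Num.Theory.
Import numFieldNormedType.Exports.

Set Implicit Arguments.
Unset Strict Implicit.
Unset Printing Implicit Defensive.

Local Open Scope classical_set_scope.
Local Open Scope ring_scope.

Inductive scalar_kind := RealScalars | ComplexScalars.

Definition scalar_field (R : realType) (k : scalar_kind) : numFieldType :=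
  match k with RealScalars => R | ComplexScalars => R[i] end.

Definition conj_scalar (R : realType) (k : scalar_kind) :
    scalar_field R k -> scalar_field R k :=
  match k return scalar_field R k -> scalar_field R k with
  | RealScalars => idfun
  | ComplexScalars => @Num.conj R[i]
  end.

Definition re_scalar (R : realType) (k : scalar_kind) : scalar_field R k -> R :=
  match k return scalar_field R k -> R with
  | RealScalars => idfun
  | ComplexScalars => @complex.Re R
  end.

Definition of_real (R : realType) (k : scalar_kind) : R -> scalar_field R k :=
  match k return R -> scalar_field R k with
  | RealScalars => idfun
  | ComplexScalars => fun x => (x%:C)%C
  end.
Arguments of_real {R} k x.

(* The inner product is linear in its first argument and conjugate-linear in
   the second; the library norm takes its values in the scalar field. *)
Record hilbertSpace (R : realType) (k : scalar_kind) := HilbertSpace {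
  hilbert_sort :> completeNormedModType (scalar_field R k) ;
  inner : {dot hilbert_sort for @conj_scalar R k} ;
  inner_norm : forall x : hilbert_sort, `|x| ^+ 2 = inner x x }.

Definition re_inner (R : realType) (k : scalar_kind) (H : hilbertSpace R k)
    (x y : H) : R := re_scalar (inner H x y).

(* The norm as an element of R, also when the scalar field is R[i]. *)
Definition rnorm (R : realType) (k : scalar_kind)
    (V : normedModType (scalar_field R k)) (x : V) : R := re_scalar `|x|.

Section Bochner.
Context d (T : measurableType d) (R : realType) (k : scalar_kind).
Variable V : normedModType (scalar_field R k).
Variables (mu : {measure set T -> \bar R}) (D : set T).
Implicit Types (f : T -> V).

Definition vsimple (s : T -> V) :=
  finite_set (s @` D) /\
  forall y, y != 0 -> measurable (D `&` s @^-1` [set y]) /\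
                      (mu (D `&` s @^-1` [set y]) < +oo)%E.

Definition vsimple_integral (s : T -> V) : V :=
  \sum_(y \in s @` D) of_real k (fine (mu (D `&` s @^-1` [set y]))) *: y.

(* The limit f need not be measurable when mu is not complete: the integral of
   a nonnegative function is a supremum over simple measurable minorants,
   hence insensitive to the null set where the convergence may fail. *)
Definition bochner_approx (s_ : nat -> T -> V) f :=
  [/\ forall n, vsimple (s_ n),
      {ae mu, forall x, D x -> s_ n x @[n --> \oo] --> f x} &
      (\int[mu]_(x in D) (rnorm (f x - s_ n x))%:E)%E @[n --> \oo] --> 0%E].

Definition bochner_integrable f := exists s_, bochner_approx s_ f.

Definition is_bochner_integral f (v : V) :=
  exists2 s_, bochner_approx s_ f &
              vsimple_integral (s_ n) @[n --> \oo] --> v.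

(* 0 is the junk value when f is not integrable on D. *)
Definition bochner_integral f : V := xget 0 [set v | is_bochner_integral f v].

End Bochner.

(* Main.v *)
(* Expanding the inner product, the hypothesis says
   |f t|^2 + M m |f s|^2 <= (M + m) Re <f t, f s>, and by AM-GM the left-hand
   side is at least 2 sqrt (M m) |f t| |f s|; hence
   |f t| |f s| <= K Re <f t, f s> with K = (M + m) / (2 sqrt (M m)), almost
   everywhere on the triangle and, by symmetry, on the whole square.
   Integrating over the square, Fubini and the weak characterization of the
   Bochner integral give A^2 <= K B^2, where K - 1 is the constant of the
   first inequality. Equality means that a function which is nonnegative almost
   everywhere has integral 0, i.e. that it vanishes almost everywhere. *)
Require Import Defs.
From HB Require Import structures.
From mathcomp Require Import all_boot all_order all_algebra.
From mathcomp Require Import finmap sesquilinear complex.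
From mathcomp Require Import all_classical all_reals all_analysis.
From mathcomp Require Import measurable_realfun.
From mathcomp Require Import ring lra.
Import Order.TTheory GRing.Theory Num.Theory.
Import numFieldNormedType.Exports.

Set Implicit Arguments.
Unset Strict Implicit.
Unset Printing Implicit Defensive.

Local Open Scope classical_set_scope.
Local Open Scope ring_scope.

(** * Real parts of scalars and the embedding of the reals *)

Section RealStructure.
Context (R : realType) (k : scalar_kind).
Implicit Types (r s : R) (z w : scalar_field R k).

Lemma re_scalarD z w : re_scalar (z + w) = re_scalar z + re_scalar w.
Proof. by case: k z w => //= -[a b] [c d]. Qed.

Lemma re_scalarN z : re_scalar (- z) = - re_scalar z.
Proof. by case: k z => //= -[a b]. Qed.

Lemma re_scalarZ r z : re_scalar (of_real k r * z) = r * re_scalar z.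
Proof. by case: k z => //= -[a b] /=; rewrite mul0r subr0. Qed.

Lemma re_scalar_conj z : re_scalar (conj_scalar z) = re_scalar z.
Proof. by case: k z => //= -[a b]. Qed.

Lemma of_realK r : re_scalar (of_real k r) = r.
Proof. by case: k. Qed.

(** In [R[i]] the order compares only numbers with equal imaginary parts, so a nonnegative scalar is
    real. *)
Lemma re_scalarK z : 0 <= z -> of_real k (re_scalar z) = z.
Proof.
case: k z => //= -[a b]; rewrite lecE/= => /andP[/eqP -> _]//.
Qed.

Lemma ler_of_real r s : (of_real k r <= of_real k s) = (r <= s).
Proof. by case: k => //=; rewrite lecR. Qed.

Lemma ltr_of_real r s : (of_real k r < of_real k s) = (r < s).
Proof. by case: k => //=; rewrite ltcR. Qed.

Lemma of_real0 : of_real k 0 = 0 :> scalar_field R k.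
Proof. by case: k. Qed.

End RealStructure.

(** * The real-valued norm *)

Section NormedSpace.
Context (R : realType) (k : scalar_kind) (V : normedModType (scalar_field R k)).
Implicit Types (x y : V) (r : R).

Lemma of_real_rnorm x : of_real k (rnorm x) = `|x|.
Proof. exact: re_scalarK. Qed.

Lemma rnorm_ge0 x : 0 <= rnorm x.
Proof. by rewrite -(ler_of_real k) of_real_rnorm of_real0. Qed.

Lemma rnorm0 : rnorm (0 : V) = 0.
Proof. by rewrite /rnorm normr0 -(of_real0 R k) of_realK. Qed.

Lemma rnorm_eq0 x : rnorm x = 0 -> x = 0.
Proof. by move=> x0; apply/normr0_eq0; rewrite -of_real_rnorm x0 of_real0. Qed.

Lemma rdistC x y : rnorm (x - y) = rnorm (y - x).
Proof. by rewrite /rnorm distrC. Qed.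

Lemma ler_rnormD x y : rnorm (x + y) <= rnorm x + rnorm y.
Proof.
by rewrite -re_scalarD -(ler_of_real k) of_real_rnorm re_scalarK ?ler_normD ?addr_ge0.
Qed.

(** Bridge from the scalar-valued norm to real sequences. The radii of the library definition are
    positive scalars, hence images of positive reals. *)
Lemma cvg_rnormP (x_ : nat -> V) x :
  x_ n @[n --> \oo] --> x <-> rnorm (x - x_ n) @[n --> \oo] --> (0 : R).
Proof.
split=> [/cvgrPdist_lt xx|/cvgrPdist_lt x0].
  apply/cvgrPdist_lt => e e0; have := xx (of_real k e).
  rewrite -(of_real0 R k) ltr_of_real => /(_ e0); apply: filterS => n /=.
  by rewrite sub0r normrN ger0_norm ?rnorm_ge0// -of_real_rnorm ltr_of_real.
apply/cvgrPdist_lt => e e0; have ek : of_real k (re_scalar e) = e.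
  by apply: re_scalarK; exact: ltW.
have e1 : 0 < re_scalar e by rewrite -(ltr_of_real k) ek of_real0.
have := x0 _ e1; apply: filterS => n /=.
by rewrite sub0r normrN ger0_norm ?rnorm_ge0// -(ltr_of_real k) of_real_rnorm ek.
Qed.

Lemma cvg_rnorm (x_ : nat -> V) x :
  x_ n @[n --> \oo] --> x -> rnorm (x_ n) @[n --> \oo] --> rnorm x.
Proof.
move=> /cvg_rnormP xx; apply/subr_cvg0/norm_cvg0P.
apply: (squeeze_cvgr _ (cvg_cst (0 : R)) xx).
apply: nearW => n; rewrite normr_ge0/= ler_norml.
have := ler_rnormD (x - x_ n) (x_ n); have := ler_rnormD (x_ n - x) x.
by rewrite !subrK (rdistC (x_ n)); lra.
Qed.

End NormedSpace.

(** * The real part of the inner product *)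

Section HilbertSpace.
Context (R : realType) (k : scalar_kind) (H : hilbertSpace R k).
Implicit Types (x y z : H) (r : R).

Lemma re_innerBl x y z : re_inner (x - y) z = re_inner x z - re_inner y z.
Proof. by rewrite /re_inner zmod_morphisml_subproof re_scalarD re_scalarN. Qed.

Lemma re_innerZl r x y : re_inner (of_real k r *: x) y = r * re_inner x y.
Proof. by rewrite /re_inner linearl_subproof re_scalarZ. Qed.

Lemma re_innerC x y : re_inner x y = re_inner y x.
Proof. by rewrite /re_inner hermitian_subproof expr0 mul1r re_scalar_conj. Qed.

Lemma re_innerBr x y z : re_inner x (y - z) = re_inner x y - re_inner x z.
Proof. by rewrite re_innerC re_innerBl !(re_innerC x). Qed.

Lemma re_innerZr r x y : re_inner x (of_real k r *: y) = r * re_inner x y.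
Proof. by rewrite re_innerC re_innerZl re_innerC. Qed.

Lemma re_inner0l y : re_inner (0 : H) y = 0.
Proof. by rewrite -(subrr (0 : H)) re_innerBl subrr. Qed.

Lemma re_inner0r x : re_inner x (0 : H) = 0.
Proof. by rewrite re_innerC re_inner0l. Qed.

Lemma re_innerDl x y z : re_inner (x + y) z = re_inner x z + re_inner y z.
Proof. by rewrite -{1}(opprK y) re_innerBl -(sub0r y) re_innerBl re_inner0l sub0r opprK. Qed.

Lemma re_innerxx x : re_inner x x = rnorm x ^+ 2.
Proof.
by rewrite /re_inner -inner_norm -of_real_rnorm !expr2 re_scalarZ of_realK.
Qed.

Lemma re_inner_suml (I : Type) (s : seq I) (F : I -> H) y :
  re_inner (\sum_(i <- s) F i) y = \sum_(i <- s) re_inner (F i) y.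
Proof.
apply: (big_morph (fun x => re_inner x y)) => [x z|]; first exact: re_innerDl.
exact: re_inner0l.
Qed.

(** Cauchy-Schwarz: the squared norm of |y|^2 x - Re <x, y> y is nonnegative and equals |y|^2 (|x|^2
    |y|^2 - (Re <x, y>)^2). *)
Lemma re_inner_le x y : `|re_inner x y| <= rnorm x * rnorm y.
Proof.
have [/rnorm_eq0->|y0] := eqVneq (rnorm y) 0.
  by rewrite re_inner0r normr0 rnorm0 mulr0.
have := sqr_ge0 (rnorm (of_real k (rnorm y ^+ 2) *: x - of_real k (re_inner x y) *: y)).
rewrite -[X in _ <= X]re_innerxx !(re_innerBl, re_innerBr, re_innerZl, re_innerZr) !re_innerxx.
rewrite (re_innerC y x); set p := re_inner x y; set q := rnorm y; set t := rnorm x.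
have q0 : 0 < q by rewrite lt_neqAle eq_sym y0 rnorm_ge0.
have t0 : 0 <= t := rnorm_ge0 x.
move=> h; have {}h : 0 <= q ^+ 2 * ((t * q) ^+ 2 - p ^+ 2).
  by move: h; congr (_ <= _); ring.
rewrite -ler_sqr ?nnegrE ?mulr_ge0// ?(ltW q0)// real_normK ?num_real//.
by move: h; rewrite pmulr_rge0 ?exprn_gt0// subr_ge0.
Qed.

Lemma cvg_re_inner (x_ y_ : nat -> H) x y :
  x_ n @[n --> \oo] --> x -> y_ n @[n --> \oo] --> y ->
  re_inner (x_ n) (y_ n) @[n --> \oo] --> re_inner x y.
Proof.
move=> /cvg_rnormP xx /cvg_rnormP yy; apply/subr_cvg0.
have h : rnorm (x - x_ n) * rnorm (y - y_ n) + rnorm (x - x_ n) * rnorm y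
    + rnorm x * rnorm (y - y_ n) @[n --> \oo] --> (0 : R).
  rewrite [X in _ --> X](_ : _ = 0 * 0 + 0 * rnorm y + rnorm x * 0); last by ring.
  by apply: cvgD; [apply: cvgD; apply: cvgM|apply: cvgM] => //; exact: cvg_cst.
apply/norm_cvg0P; apply: (squeeze_cvgr _ (cvg_cst (0 : R)) h).
apply: nearW => n /=; rewrite normr_ge0/=.
have -> : re_inner (x_ n) (y_ n) - re_inner x y = re_inner (x - x_ n) (y - y_ n)
    - re_inner (x - x_ n) y - re_inner x (y - y_ n).
  by rewrite !(re_innerBl, re_innerBr); ring.
rewrite (le_trans (ler_normB _ _))// lerD ?re_inner_le//.
by rewrite (le_trans (ler_normB _ _))// lerD ?re_inner_le.
Qed.

End HilbertSpace.

(** * Removing a null set from a nonnegative integral *)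

Section NegligibleIntegral.
Context d (T : measurableType d) (R : realType) (mu : {measure set T -> \bar R}).
Local Open Scope ereal_scope.
Import HBNNSimple.

(* Unlike [ge0_negligible_integral], [f] need not be measurable on [D]. *)
Lemma ge0_integral_setD_negligible (D N : set T) (f : T -> \bar R) :
  measurable N -> measurable D -> measurable_fun (D `\` N) f ->
  (forall x, D x -> 0 <= f x) -> mu N = 0 ->
  \int[mu]_(x in D) f x = \int[mu]_(x in D `\` N) f x.
Proof.
move=> mN mD mf f0 muN0; have mDN := measurableD mD mN.
set f1 := f \_ (D `\` N).
have f10 x : 0 <= f1 x by apply: erestrict_ge0 => y [/f0].
have mf1 : measurable_fun setT f1 by apply/(measurable_restrictT _ _).1.
apply/eqP; rewrite eq_le; apply/andP; split; last first.
  rewrite !ge0_integralE//; last by move=> x [/f0].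
  apply: le_ereal_sup => _ [h /= hf <-]; exists h => // x.
  rewrite (le_trans (hf x))// /f1 !patchE.
  case: ifPn => [|_]; first by rewrite inE => -[Dx _]; rewrite mem_set.
  by case: ifPn => // /set_mem /f0.
(* A simple minorant [h] of [f] on [D] is measurable even if [f] is not: dropping [N] leaves its
   integral unchanged, and off [N] it lies below [f1]. *)
rewrite [leLHS]ge0_integralE//; apply: ge_ereal_sup => _ [h /= hf <-].
have mh A : measurable_fun A (EFin \o h).
  by apply/measurable_EFinP; apply: measurable_funS (measurable_funPT h).
have h0 x : 0 <= (h x)%:E by rewrite lee_fin; exact: fun_ge0.
rewrite -integralT_nnsfun (ge0_negligible_integral mN)// setTD.
rewrite [leRHS]integral_mkcond -/f1.
apply: (@le_trans _ _ (\int[mu]_(x in ~` N) f1 x)).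
  apply: ge0_le_integral => //; first exact: measurableC.
    exact: measurable_funS mf1.
  move=> x Nx; rewrite (le_trans (hf x))// /f1 !patchE in_setD.
  by rewrite (memNset Nx) andbT.
by apply: ge0_subset_integral => //; exact: measurableC.
Qed.

End NegligibleIntegral.

(** * Functions with finitely many values and measurable fibres *)

(** Measurable fibres stand in for a sigma-algebra on [V]. Unlike [vsimple], the notion involves
    neither a measure nor the value 0, so it passes to the product space by precomposition with the
    projections. *)
Definition fin_measurable d (T : measurableType d) (V : Type) (D : set T)
    (s : T -> V) :=
  finite_set (s @` D) /\ forall z, measurable (D `&` s @^-1` [set z]).

Section FinMeasurable.
Context d (T : measurableType d) (R : realType) (V W : Type).

(** Any preimage is a finite union of intersections of fibres, whatever the function [G]. *)
Lemma fin_measurable_comp2 (D : set T) (s : T -> V) (s' : T -> W) (G : V -> W -> R) :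
  fin_measurable D s -> fin_measurable D s' ->
  measurable_fun D (fun x => G (s x) (s' x)).
Proof.
move=> [fs ms] [fs' ms'] _ Y _.
pose Z := (s @` D) `*` (s' @` D) `&` [set p | Y (G p.1 p.2)].
rewrite [X in measurable X](_ : _ = \bigcup_(p in Z)
    ((D `&` s @^-1` [set p.1]) `&` (D `&` s' @^-1` [set p.2]))).
  apply: fin_bigcup_measurable => [|p _]; last exact: measurableI.
  by apply: sub_finite_set (finite_setX fs fs') => p [].
apply/seteqP; split=> [x [Dx Yx]|x [[z w] [_ /= Yzw]] [[Dx /= sz] [_ /= sw]]].
  by exists (s x, s' x) => //=; split=> //; split; exists x.
by split=> //=; rewrite sz sw.
Qed.

Lemma fin_measurableS (D E : set T) (s : T -> V) :
  measurable E -> E `<=` D -> fin_measurable D s -> fin_measurable E s.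
Proof.
move=> mE ED [fs ms]; split; first exact: sub_finite_set (image_subset _ ED) fs.
move=> z; rewrite [X in measurable X](_ : _ = E `&` (D `&` s @^-1` [set z])).
  exact: measurableI.
by rewrite setIA (setIidl ED).
Qed.

Lemma fin_measurable_patch (E : set T) (s : T -> V) (z : V) :
  measurable E -> fin_measurable E s -> fin_measurable setT (patch (cst z) E s).
Proof.
move=> mE [fs ms]; split.
  apply: (@sub_finite_set _ _ (s @` E `|` [set z])).
    move=> _ [x _ <-]; rewrite /patch; case: ifPn => [/set_mem Ex|_]; last by right.
    by left; exists x.
  by rewrite finite_setU; split=> //; exact: finite_set1.
move=> w; rewrite setTI.
rewrite [X in measurable X](_ : _ = (E `&` s @^-1` [set w]) `|`
    (~` E `&` [set _ | z = w])).
  apply: measurableU => //; have [->|zw] := pselect (z = w).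
    by rewrite (_ : [set _ | _] = setT) ?setIT; [exact: measurableC|exact/seteqP].
  by rewrite (_ : [set _ | _] = set0) ?setI0//; apply/seteqP; split.
apply/seteqP; split=> x /=; rewrite /patch; case: ifPn.
- by move=> /set_mem Ex sx; left.
- by move=> /negP xE zw; right; split=> // /mem_set.
- by move=> /set_mem Ex [[]|[]].
- by move=> /negP xE [[/mem_set]|[_]].
Qed.

End FinMeasurable.

Lemma fin_measurable_precomp d d' (T : measurableType d) (U : measurableType d')
    (V : Type) (s : T -> V) (h : U -> T) :
  measurable_fun setT h -> fin_measurable setT s -> fin_measurable setT (s \o h).
Proof.
move=> mh [fs ms]; split.
  by apply: sub_finite_set fs => _ [x _ <-]; exists (h x).
by move=> z; rewrite setTI comp_preimage -[X in measurable X]setTI;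
  apply: mh => //; rewrite -[X in measurable X]setTI.
Qed.

(** * Simple functions and their integrals *)

Section VSimple.
Context d (T : measurableType d) (R : realType) (k : scalar_kind).
Context (V : normedModType (scalar_field R k)) (mu : {measure set T -> \bar R}).
Variables (D : set T) (mD : measurable D) (s : T -> V) (ss : vsimple mu D s).

(** The fibre over 0, on which [vsimple] is silent, is the complement in [D] of the finitely many
    others. *)
Lemma vsimple_fin_measurable : fin_measurable D s.
Proof.
have [fs ms] := ss; split=> // z; have [->|/ms[]//] := eqVneq z 0.
rewrite [X in measurable X](_ : _ = D `\` \bigcup_(y in s @` D `\ 0)
    (D `&` s @^-1` [set y])).
  apply: measurableD => //; apply: fin_bigcup_measurable => [|y [_ /eqP /ms[]//]].
  by apply: sub_finite_set fs => y [].
apply/seteqP; split=> x [Dx /=].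
  by move=> sx; split=> // -[y [_ /= y0] [_ /= sy]]; apply: y0; rewrite -sy.
move=> nx; split=> //; apply: contrapT => sx; apply: nx.
by exists (s x); split=> //; exists x.
Qed.

(** The fibre over 0 may have infinite measure, which [fine] turns into 0; [F 0 = 0] makes its
    contribution vanish on both sides. [F] is arbitrary so as to serve both for [rnorm] and for
    [re_inner] against a fixed vector. *)
Lemma integral_vsimple (F : V -> R) : F 0 = 0 ->
  mu.-integrable D (fun x => (F (s x))%:E) /\
  (\int[mu]_(x in D) (F (s x))%:E = (\sum_(z <- fset_set (s @` D))
    fine (mu (D `&` s @^-1` [set z])) * F z)%:E)%E.
Proof.
move=> F0; have [fs ms] := ss; have [_ mfs] := vsimple_fin_measurable.
pose t z x := (F z * \1_(D `&` s @^-1` [set z]) x)%:E.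
have tE x : x \in D -> ((F (s x))%:E = \sum_(z <- fset_set (s @` D)) t z x)%E.
  move=> /set_mem Dx.
  rewrite (bigD1_seq (s x)) ?fset_uniq//=; last first.
    by rewrite in_fset_set// inE; exists x.
  rewrite big1 ?adde0 => [|z zsx]; last first.
    by rewrite /t indicE memNset ?mulr0// => -[_ /= sxz]; rewrite sxz eqxx in zsx.
  by rewrite /t indicE mem_set ?mulr1.
have iI z : z != 0 -> mu.-integrable D (EFin \o \1_(D `&` s @^-1` [set z])).
  move=> /ms[mz fz]; apply/integrableP; split.
    by apply/measurable_EFinP; exact: measurable_indic.
  under eq_integral do rewrite gee0_abs ?lee_fin//.
  by rewrite integral_indic// setIAC setIid.
have it z : mu.-integrable D (t z).
  rewrite /t; under eq_fun do rewrite EFinM.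
  have [->|z0] := eqVneq z 0.
    by rewrite F0; under eq_fun do rewrite mul0e; exact: integrable0.
  by apply: integrableZl => //; exact: iI.
split.
  apply: (@eq_integrable _ _ _ mu _ mD
    (fun x => (\sum_(z <- fset_set (s @` D)) t z x)%E)) => [x /tE -> //|].
  exact: integrable_sum.
rewrite (eq_integral _ _ tE) integral_sum//.
rewrite -sumEFin; apply: eq_bigr => z _.
have [->|z0] := eqVneq z 0.
  by rewrite F0 mulr0 integral0_eq// /t => x _; rewrite F0 mul0r.
have [? ?] := ms _ z0.
rewrite /t; under eq_integral do rewrite EFinM.
rewrite integralZl//; last exact: iI.
rewrite integral_indic// setIAC setIid EFinM fineK ?ge0_fin_numE// muleC//.
Qed.

End VSimple.

(** * Measurability of real functions built from pointwise limits *)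

Section PointwiseLimits.
Context d (U : measurableType d) (R : realType) (k : scalar_kind).
Context (H : hilbertSpace R k) (D : set U) (x_ y_ : nat -> U -> H) (x y : U -> H).
Hypotheses (mx : forall n, fin_measurable D (x_ n))
  (my : forall n, fin_measurable D (y_ n)).
Hypotheses (xx : forall u, D u -> x_ n u @[n --> \oo] --> x u)
  (yy : forall u, D u -> y_ n u @[n --> \oo] --> y u).

Lemma measurable_re_inner_lim : measurable_fun D (fun u => re_inner (x u) (y u)).
Proof.
apply: (@measurable_fun_cvg _ _ _ _ (fun n u => re_inner (x_ n u) (y_ n u))).
  by move=> n; exact: fin_measurable_comp2.
by move=> u Du; apply: cvg_re_inner; [exact: xx|exact: yy].
Qed.

Lemma measurable_rdist_lim : measurable_fun D (fun u => rnorm (x u - y u)).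
Proof.
apply: (@measurable_fun_cvg _ _ _ _ (fun n u => rnorm (x_ n u - y_ n u))).
  by move=> n; apply: (fin_measurable_comp2 (fun z w => rnorm (z - w))).
by move=> u Du; apply: cvg_rnorm; apply: cvgB; [exact: xx|exact: yy].
Qed.

End PointwiseLimits.

Lemma fin_measurable_cst d (U : measurableType d) (V : Type) (D : set U) (z : V) :
  measurable D -> fin_measurable D (cst z).
Proof.
move=> mD; split; first by apply: sub_finite_set (finite_set1 z) => _ [u _ <-].
move=> w; have [->|wz] := pselect (z = w).
  by rewrite (_ : _ @^-1` _ = setT) ?setIT//; exact/seteqP.
by rewrite (_ : _ @^-1` _ = set0) ?setI0//; apply/seteqP; split.
Qed.

(** * Existence and weak characterization of the Bochner integral *)

Section BochnerIntegral.
Context d (T : measurableType d) (R : realType) (k : scalar_kind).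
Context (H : hilbertSpace R k) (mu : {measure set T -> \bar R}).
Variables (D : set T) (mD : measurable D).

Lemma integral_re_inner_vsimple (s : T -> H) (z : H) : vsimple mu D s ->
  mu.-integrable D (EFin \o (fun x => re_inner (s x) z)) /\
  \int[mu]_(x in D) re_inner (s x) z = re_inner (vsimple_integral mu D s) z.
Proof.
move=> ss; have [fs _] := ss.
have [? Is] := integral_vsimple (F := fun y : H => re_inner y z) mD ss (re_inner0l z).
split=> //.
rewrite /Rintegral Is/= /vsimple_integral fsbig_finite// re_inner_suml.
by apply: eq_bigr => y _; rewrite re_innerZl.
Qed.

Variables (f : T -> H) (s_ : nat -> T -> H) (N : set T).
Hypotheses (mN : measurable N) (N0 : mu N = 0%E).
Hypothesis s_simple : forall n, vsimple mu D (s_ n).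
Hypothesis s_cvg : forall x, (D `\` N) x -> s_ n x @[n --> \oo] --> f x.
Hypothesis s_int0 :
  (\int[mu]_(x in D) (rnorm (f x - s_ n x))%:E)%E @[n --> \oo] --> 0%E.

(** On [E] the simple functions converge at every point, which gives the measurability that may fail
    on [D]. *)
Let E := D `\` N.
Let mE : measurable E. Proof. exact: measurableD. Qed.
Let ED : E `<=` D. Proof. exact: subDsetl. Qed.
Let fs n : fin_measurable E (s_ n).
Proof. exact: fin_measurableS mE ED (vsimple_fin_measurable mD (s_simple n)). Qed.

Lemma measurable_rdist_approx n : measurable_fun E (fun x => rnorm (f x - s_ n x)).
Proof.
by apply: (@measurable_rdist_lim _ _ _ _ _ _ s_ (fun=> s_ n)) => // x Ex; exact: cvg_cst.
Qed.

Lemma measurable_re_inner_approx z : measurable_fun E (fun x => re_inner (f x) z).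
Proof.
apply: (@measurable_re_inner_lim _ _ _ _ _ _ s_ (fun _ _ => z) f (cst z)) => //.
  by move=> _; exact: fin_measurable_cst.
by move=> x Ex; exact: cvg_cst.
Qed.

Let delta n := \int[mu]_(x in E) rnorm (f x - s_ n x).

(** The first integrals of the sequence may be infinite; convergence to a finite limit makes them
    finite from some rank on, hence the eventual form of integrability. *)
Let delta_int0 : (\forall n \near \oo,
    mu.-integrable E (EFin \o (fun x => rnorm (f x - s_ n x)))) /\
  delta n @[n --> \oo] --> (0 : R).
Proof.
have eqE n : (\int[mu]_(x in D) (rnorm (f x - s_ n x))%:E =
    \int[mu]_(x in E) (rnorm (f x - s_ n x))%:E)%E.
  apply: ge0_integral_setD_negligible => //; last by move=> *; rewrite lee_fin rnorm_ge0.
  by apply/measurable_EFinP; exact: measurable_rdist_approx.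
move: s_int0; under eq_fun do rewrite eqE.
move=> /fine_cvgP[fin cv]; split => //.
apply: filterS fin => n fn; apply/integrableP; split.
  by apply/measurable_EFinP; exact: measurable_rdist_approx.
under eq_integral do rewrite gee0_abs ?lee_fin ?rnorm_ge0//.
by rewrite ltey_eq fn.
Qed.

(** Write f = (f - s_n) + s_n: Cauchy-Schwarz dominates the first term by |f - s_n| |z|, and the
    second is known for simple functions. *)
Let integral_re_inner_dist n z :
  mu.-integrable E (EFin \o (fun x => rnorm (f x - s_ n x))) ->
  mu.-integrable E (EFin \o (fun x => re_inner (f x) z)) /\
  `|\int[mu]_(x in E) re_inner (f x) z - re_inner (vsimple_integral mu D (s_ n)) z|
    <= delta n * rnorm z.
Proof.
move=> dn; have [isD Is] := integral_re_inner_vsimple z (s_simple n).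
have si : mu.-integrable E (EFin \o (fun x => re_inner (s_ n x) z)).
  exact: integrableS isD.
have mfs : measurable_fun E (fun x => re_inner (f x - s_ n x) z).
  under eq_fun do rewrite re_innerBl.
  apply: measurable_funB; first exact: measurable_re_inner_approx.
  exact: (fin_measurable_comp2 (fun y _ => re_inner y z) (fs n) (fs n)).
have idz : mu.-integrable E (EFin \o (fun x => rnorm (f x - s_ n x) * rnorm z)).
  by apply: eq_integrable (integrableZr mE (rnorm z) dn) => // x _ /=; rewrite EFinM.
have ifs : mu.-integrable E (EFin \o (fun x => re_inner (f x - s_ n x) z)).
  apply: le_integrable idz => //; first exact/measurable_EFinP.
  move=> x Ex; rewrite /= lee_fin [leRHS]ger0_norm ?mulr_ge0 ?rnorm_ge0//.
  exact: re_inner_le.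
have if_ : mu.-integrable E (EFin \o (fun x => re_inner (f x) z)).
  apply: eq_integrable (integrableD mE ifs si) => // x _ /=.
  by rewrite -EFinD re_innerBl subrK.
split=> //; rewrite -Is.
rewrite (_ : \int[mu]_(x in D) _ = \int[mu]_(x in E) re_inner (s_ n x) z); last first.
  by rewrite /Rintegral (negligible_integral mN mD).
rewrite -RintegralB//; under eq_Rintegral do rewrite -re_innerBl.
apply: (le_trans (le_normr_Rintegral mE ifs)).
rewrite -RintegralZr//; apply: le_Rintegral => //.
  exact: (integrable_norm ifs).
by move=> x Ex; exact: re_inner_le.
Qed.

(* With w the difference of two terms, testing against w bounds |w|^2 by
   (delta p + delta n) |w|, so neither linearity of the integral on simple
   functions nor its triangle inequality is needed. *)
Lemma cvg_vsimple_integral : cvg (vsimple_integral mu D (s_ n) @[n --> \oo]).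
Proof.
apply: cauchy_cvg; apply: cauchy_exP => e e0.
have ek : of_real k (re_scalar e) = e by apply: re_scalarK; exact: ltW.
have e1 : 0 < re_scalar e by rewrite -(ltr_of_real k) ek of_real0.
have [ni /cvgrPdist_lt/(_ (re_scalar e / 2))] := delta_int0.
rewrite divr_gt0// => /(_ isT) nd.
have {ni nd} [n0 _ hn0] := filterI ni nd.
(* This form of the Cauchy criterion asks for one ball containing a tail; its centre is the integral
   at rank [n0], where [delta] is already below half the radius. *)
exists (vsimple_integral mu D (s_ n0)); exists n0 => // n n0n.
have [/= in0 dn0] := hn0 _ (leqnn n0); have [/= in_ dn] := hn0 _ n0n.
have d0 m : 0 <= delta m by apply: Rintegral_ge0 => x _; exact: rnorm_ge0.
rewrite !sub0r !normrN !ger0_norm// in dn0 dn.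
rewrite -ball_normE/= -of_real_rnorm -ek ltr_of_real.
set w := _ - _; have [->//|w0] := eqVneq (rnorm w) 0.
have wp : 0 < rnorm w by rewrite lt_neqAle eq_sym w0 rnorm_ge0.
have [_ h0] := integral_re_inner_dist w in0.
have [_ h1] := integral_re_inner_dist w in_.
have : rnorm w ^+ 2 <= (delta n0 + delta n) * rnorm w.
  rewrite -re_innerxx {1}/w re_innerBl mulrDl.
  move: h0 h1; rewrite !ler_norml; lra.
by rewrite expr2 ler_pM2r// => /le_lt_trans; apply; lra.
Qed.

(** Both sides are limits of the simple integrals tested against [z]. This weak identity is the only
    property of the integral used in the Fubini argument. *)
Lemma integral_re_inner_lim (v : H) :
  vsimple_integral mu D (s_ n) @[n --> \oo] --> v -> forall z,
  mu.-integrable E (EFin \o (fun x => re_inner (f x) z)) /\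
  \int[mu]_(x in E) re_inner (f x) z = re_inner v z.
Proof.
move=> Iv z; have [ni d0] := delta_int0.
have [n0 _ /(_ _ (leqnn n0)) in0] := ni.
have [if_ _] := integral_re_inner_dist z in0; split=> //.
have Ivz : re_inner (vsimple_integral mu D (s_ n)) z @[n --> \oo] --> re_inner v z.
  by apply: cvg_re_inner => //; exact: cvg_cst.
suff Iz : re_inner (vsimple_integral mu D (s_ n)) z @[n --> \oo] -->
    \int[mu]_(x in E) re_inner (f x) z.
  exact: (cvg_unique _ Iz Ivz).
apply/subr_cvg0/norm_cvg0P.
have dz : delta n * rnorm z @[n --> \oo] --> (0 : R).
  by rewrite -(mul0r (rnorm z)); apply: cvgM => //; exact: cvg_cst.
apply: (squeeze_cvgr _ (cvg_cst (0 : R)) dz).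
by apply: filterS ni => n /(integral_re_inner_dist z)[_]; rewrite normr_ge0 distrC.
Qed.

(** Domination by |f - s_n| + |s_n| for a single n at which the distance is integrable. *)
Lemma integrable_rnorm_approx :
  mu.-integrable E (EFin \o (fun x => rnorm (f x))).
Proof.
have [[n0 _ /(_ _ (leqnn n0)) in0] _] := delta_int0.
have [isD _] := integral_vsimple (F := @rnorm _ _ H) mD (s_simple n0) (@rnorm0 _ _ H).
have si : mu.-integrable E (EFin \o (fun x => rnorm (s_ n0 x))).
  exact: integrableS isD.
apply: le_integrable (integrableD mE in0 si) => //.
  (* Writing f = f - 0 makes the norm a distance between two limits, the second sequence being
     constantly 0. *)
  apply/measurable_EFinP; under eq_fun do rewrite -[f _]subr0.
  apply: (@measurable_rdist_lim _ _ _ _ _ _ s_ (fun _ _ => 0)) => //.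
    by move=> _; exact: fin_measurable_cst.
  by move=> x Ex; exact: cvg_cst.
move=> x Ex; rewrite /= lee_fin !ger0_norm ?addr_ge0 ?rnorm_ge0//.
by rewrite (le_trans _ (ler_rnormD _ _))// subrK.
Qed.

End BochnerIntegral.

(** Completeness of [H] provides a limit, so [xget] returns a genuine integral and not its default
    value. *)
Lemma bochner_integralP d (T : measurableType d) (R : realType) (k : scalar_kind)
    (H : hilbertSpace R k) (mu : {measure set T -> \bar R}) (D : set T) (f : T -> H) :
  measurable D -> bochner_integrable mu D f ->
  is_bochner_integral mu D f (bochner_integral mu D f).
Proof.
move=> mD [s_ [ss sf s0]].
case: (sf) => N [mN N0 sN].
have sc x : (D `\` N) x -> s_ n x @[n --> \oo] --> f x.
  by move=> [Dx Nx]; apply: contrapT => nc; apply/Nx/sN => /= /(_ Dx).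
have /cvg_ex[v Iv] := cvg_vsimple_integral mD mN N0 ss sc s0.
by apply: (@xgetPex _ _ [set v | is_bochner_integral mu D f v]); exists v, s_.
Qed.

(** * Fubini on the square *)

Section ProductIntegral.
Context d (T : measurableType d) (R : realType) (k : scalar_kind).
Context (H : hilbertSpace R k) (mu : {sigma_finite_measure set T -> \bar R}).

(* [f] is replaced by 0 off a set where it is a pointwise limit of simple
   functions: this makes the integrands measurable on the whole product. *)
Lemma bochner_integral_product (D : set T) (f : T -> H) :
  measurable D -> bochner_integrable mu D f ->
  exists N, [/\ measurable N, mu N = 0%E &
    let g := patch (cst 0) (D `\` N) f in
    let I1 p := re_inner (g p.1) (g p.2) in
    let I2 p := rnorm (g p.1) * rnorm (g p.2) in
    [/\ (mu \x mu)%E.-integrable setT (EFin \o I1),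
        (mu \x mu)%E.-integrable setT (EFin \o I2),
        \int[(mu \x mu)%E]_p I1 p = rnorm (bochner_integral mu D f) ^+ 2 &
        \int[(mu \x mu)%E]_p I2 p = (\int[mu]_(t in D) rnorm (f t)) ^+ 2]].
Proof.
move=> mD /(bochner_integralP mD).
set v := bochner_integral mu D f; move: v => v [s_ [ss sf s0] Iv].
case: (sf) => N [mN N0 sN]; exists N; split=> //.
have sc x : (D `\` N) x -> s_ n x @[n --> \oo] --> f x.
  by move=> [Dx Nx]; apply: contrapT => nc; apply/Nx/sN => /= /(_ Dx).
have weak := integral_re_inner_lim mD mN N0 ss sc s0 Iv.
have inorm := integrable_rnorm_approx mD mN N0 ss sc s0.
have mE : measurable (D `\` N) by exact: measurableD.
have -> : \int[mu]_(t in D) rnorm (f t) = \int[mu]_(t in D `\` N) rnorm (f t).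
  congr fine; apply: ge0_integral_setD_negligible => //.
    exact: (measurable_int mu inorm).
  by move=> x _; rewrite lee_fin rnorm_ge0.
have ms n : fin_measurable (D `\` N) (s_ n).
  exact: fin_measurableS mE (@subDsetl _ _ _) (vsimple_fin_measurable mD (ss n)).
move: (D `\` N) mE sc weak inorm ms => E mE sc weak inorm ms g I1 I2.
pose g_ n := patch (cst (0 : H)) E (s_ n).
have mg n : fin_measurable setT (g_ n) by exact: fin_measurable_patch.
have gc x : g_ n x @[n --> \oo] --> g x.
  rewrite /g_ /g /patch; case: ifPn => [/set_mem Ex|_]; first exact: sc.
  exact: cvg_cst.
have mg1 n : fin_measurable setT (g_ n \o @fst T T).
  exact: fin_measurable_precomp.
have mg2 n : fin_measurable setT (g_ n \o @snd T T).
  exact: fin_measurable_precomp.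
have mI1 : measurable_fun setT I1.
  by apply: (measurable_re_inner_lim mg1 mg2) => u _ /=; exact: gc.
(* A functional that vanishes at 0 commutes with extension by 0, which turns integrals over [E] into
   integrals over the whole space. *)
have gfun (F : H -> R) x : F 0 = 0 -> (F (g x))%:E = ((EFin \o (F \o f)) \_ E) x.
  by rewrite patchE /g /patch => F0; case: ifPn => //= _; rewrite F0.
have iF (F : H -> R) : F 0 = 0 -> mu.-integrable E (EFin \o (F \o f)) ->
    mu.-integrable setT (fun x => (F (g x))%:E).
  move=> F0 /(integrable_mkcond _ mE); apply: eq_integrable => // x _.
  by rewrite -gfun.
have IF (F : H -> R) : F 0 = 0 ->
    (\int[mu]_x (F (g x))%:E = \int[mu]_(x in E) (F (f x))%:E)%E.
  by move=> F0; rewrite [RHS]integral_mkcond; apply: eq_integral => x _; rewrite gfun.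
have ing := iF _ (@rnorm0 _ _ H) inorm.
set A := \int[mu]_(t in E) rnorm (f t).
have IA : (\int[mu]_x (rnorm (g x))%:E = A%:E)%E.
  by rewrite IF ?rnorm0// fineK//; apply: integrable_fin_num.
have IwE z : (\int[mu]_x (re_inner (g x) z)%:E = (re_inner v z)%:E)%E.
  rewrite (IF (fun y => re_inner y z)) ?re_inner0l//.
  have [iz <-] := weak z; rewrite fineK//; exact: integrable_fin_num.
have mgn : measurable_fun setT (fun x => rnorm (g x)).
  by apply/measurable_EFinP; exact: measurable_int ing.
have mI2 : measurable_fun setT I2.
  apply: measurable_funM; first exact: (measurableT_comp mgn measurable_fst).
  exact: (measurableT_comp mgn measurable_snd).
have I2y x : (\int[mu]_y (I2 (x, y))%:E = A%:E * (rnorm (g x))%:E)%E.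
  rewrite /I2/=; under eq_integral do rewrite EFinM.
  by rewrite integralZl// IA muleC.
(* Tonelli: the iterated integral is A^2, hence finite. [I1] is then dominated by [I2] through
   Cauchy-Schwarz. *)
have iI2 : (mu \x mu)%E.-integrable setT (EFin \o I2).
  apply/(integrable12ltyP mu mu); first exact/measurable_EFinP.
  under eq_integral => x _.
    under eq_integral => y _.
      rewrite /= ger0_norm ?mulr_ge0 ?rnorm_ge0//; over.
    rewrite I2y; over.
  by rewrite integralZl// IA -EFinM ltry.
have iI1 : (mu \x mu)%E.-integrable setT (EFin \o I1).
  apply: le_integrable iI2 => //; first exact/measurable_EFinP.
  move=> p _; rewrite /= lee_fin [leRHS]ger0_norm ?mulr_ge0 ?rnorm_ge0//.
  exact: re_inner_le.
split=> //; rewrite /Rintegral.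
  (* The weak identity is applied twice: the inner integral is Re <v, g x>, and integrating that in
     x gives Re <v, v>. *)
  rewrite -(integral12_prod_meas1 iI1) /fubini_F/=.
  under eq_integral => x _.
    under eq_integral => y _ do rewrite /I1/= re_innerC.
    rewrite IwE re_innerC; over.
  by rewrite /= IwE re_innerxx.
rewrite -(integral12_prod_meas1 iI2) /fubini_F/=.
under eq_integral do rewrite I2y.
by rewrite integralZl// IA.
Qed.

End ProductIntegral.

(** * Almost everywhere statements on the square and the triangle *)

(** Reflection exchanges the two kinds of sections, so the measure of the mirror image of [N] is
    that of [N] integrated in the other order; uniqueness of the product measure identifies the
    two. *)
Lemma negligible_swap d (T : measurableType d) (R : realType)
    (mu : {sigma_finite_measure set T -> \bar R}) (X : set (T * T)) :
  (mu \x mu)%E.-negligible X -> (mu \x mu)%E.-negligible [set p | X (p.2, p.1)].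
Proof.
move=> [N [mN N0 XN]]; exists [set p | N (p.2, p.1)]; split.
- by rewrite -[X in measurable X]setTI; exact: (measurable_swap _ mN).
- rewrite -[RHS]N0.
  transitivity ((mu \x^ mu)%E N).
    rewrite /product_measure1 /product_measure2; apply: eq_integral => x _ /=.
    by congr (mu _); apply/seteqP; split=> y; rewrite /xsection /ysection/= !inE.
  apply/esym/product_measure_unique => // A B mA mB.
  exact: product_measure2E.
- by move=> p; exact: XN.
Qed.

Lemma ae_imply d (T : measurableType d) (R : realType)
    (mu : {measure set T -> \bar R}) (P Q : T -> Prop) :
  (forall x, P x -> Q x) -> {ae mu, forall x, P x} -> {ae mu, forall x, Q x}.
Proof. by move=> PQ; exact: filterS. Qed.

(** Almost everywhere [q] equals its absolute value, to which the vanishing criterion for integrals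
    applies. *)
Lemma ae_ge0_integral d (T : measurableType d) (R : realType)
    (mu : {measure set T -> \bar R}) (q : T -> R) :
  mu.-integrable setT (EFin \o q) -> {ae mu, forall x, 0 <= q x} ->
  0 <= \int[mu]_x q x /\ (\int[mu]_x q x = 0 <-> {ae mu, forall x, q x = 0}).
Proof.
move=> iq q0; have mq := measurable_int mu iq.
have -> : \int[mu]_x q x = \int[mu]_x `|q x|.
  congr fine; apply: ae_eq_integral => //.
    exact: (measurable_int mu (integrable_norm iq)).
  by apply: filterS q0 => x qx _; rewrite ger0_norm.
split; first by apply: Rintegral_ge0.
(* A zero real integral could come from an infinite one, since [fine] sends infinity to 0;
   integrability excludes this. *)
have <- : (\int[mu]_x `|(q x)%:E| = 0)%E <-> \int[mu]_x `|q x| = 0.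
  split=> [|qn0]; first by rewrite /Rintegral => ->.
  transitivity (\int[mu]_x `|q x|)%:E; last by rewrite qn0.
  by rewrite fineK//; apply: integrable_fin_num => //; exact: integrable_norm.
rewrite (ae_eq_integral_abs mu measurableT mq); split; apply: filterS => x.
  by move=> /(_ I)[].
by move=> qx _; rewrite /= qx.
Qed.

(* The triangle and its mirror image cover the square. *)
Lemma ae_triangle (R : realType) (a b : R) (N : set (measurableTypeR R)) (Q : R -> R -> Prop) :
  measurable N -> @lebesgue_measure R N = 0%E -> (forall t s, Q t s -> Q s t) ->
  {ae (@lebesgue_measure R \x @lebesgue_measure R)%E, forall p : R * R,
     a <= p.1 /\ p.1 <= p.2 /\ p.2 <= b -> Q p.1 p.2} <->
  {ae (@lebesgue_measure R \x @lebesgue_measure R)%E, forall p : R * R,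
     (`[a, b] `\` N) p.1 -> (`[a, b] `\` N) p.2 -> Q p.1 p.2}.
Proof.
set mu := @lebesgue_measure R; move=> mN N0 Qsym; split=> h.
  have h' := negligible_swap h.
  have := negligibleU h h'; apply: negligibleS => -[t s] /=.
  move=> /not_implyP[[/= tab Nt]] /not_implyP[[/= sab Ns] nQ].
  move: tab sab; rewrite !in_itv/= => /andP[at_ tb] /andP[as_ sb].
  have [ts|/ltW st] := leP t s; [left|right]; rewrite /= => hQ.
    by apply: nQ; apply: hQ.
  by apply/nQ/Qsym/hQ.
(* Conversely, the triangle is covered by the restricted square and two strips over [N]; these are
   null although the other factor has infinite measure, by the convention that 0 times infinity is
   0. *)
have N1 : (mu \x mu)%E.-negligible (N `*` setT).
  exists (N `*` setT); split=> //; first exact: measurableX.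
  by transitivity (mu N * mu setT)%E; [exact: product_measure1E|rewrite N0 mul0e].
have N2 : (mu \x mu)%E.-negligible (setT `*` N).
  exists (setT `*` N); split=> //; first exact: measurableX.
  by transitivity (mu setT * mu N)%E; [exact: product_measure1E|rewrite N0 mule0].
have := negligibleU (negligibleU h N1) N2; apply: negligibleS => -[t s] /=.
move=> /not_implyP[[at_ [ts sb]] nQ].
have [Nt|Nt] := pselect (N t); first by left; right.
have [Ns|Ns] := pselect (N s); first by right.
left; left => /= hQ; apply: nQ; apply: hQ; split=> //; rewrite /= in_itv/=.
  by rewrite at_ (le_trans ts).
by rewrite sb (le_trans at_).
Qed.

(** * Pointwise inequalities and the constants *)

Section PointwiseInequalities.
Context (R : realType) (k : scalar_kind) (H : hilbertSpace R k).
Variables (M m : R) (m0 : 0 < m) (mM : m <= M).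
Implicit Types x y : H.

(** By expansion, Re <My - x, x - my> = ((M - m)/2)^2 |y|^2 - |x - (M + m)/2 y|^2; [mM] makes
    squaring reversible. *)
Lemma re_inner_ge0_iff_rdist_le x y :
  0 <= re_inner (of_real k M *: y - x) (x - of_real k m *: y) <->
  rnorm (x - of_real k ((M + m) / 2) *: y) <= 1 / 2 * (M - m) * rnorm y.
Proof.
have y0 : 0 <= 1 / 2 * (M - m) * rnorm y.
  by rewrite mulr_ge0 ?rnorm_ge0// mulr_ge0// subr_ge0.
rewrite -[rnorm _ <= _]ler_sqr ?nnegrE ?rnorm_ge0//.
rewrite exprMn -!re_innerxx.
rewrite !(re_innerBl, re_innerBr, re_innerZl, re_innerZr) (re_innerC y x).
by split=> h; rewrite -subr_ge0; move: h; rewrite -subr_ge0; congr (_ <= _); field.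
Qed.

Lemma rnorm_mul_le x y :
  0 <= re_inner (of_real k M *: y - x) (x - of_real k m *: y) ->
  rnorm x * rnorm y <= (M + m) / (2 * Num.sqrt (M * m)) * re_inner x y.
Proof.
have M0 : 0 < M := lt_le_trans m0 mM.
rewrite !(re_innerBl, re_innerBr, re_innerZl, re_innerZr) (re_innerC y x) !re_innerxx.
move=> h; have w0 : 0 < Num.sqrt (M * m) by rewrite sqrtr_gt0 mulr_gt0.
rewrite mulrAC ler_pdivlMr ?mulr_gt0//.
have := sqr_ge0 (rnorm x - Num.sqrt (M * m) * rnorm y).
have : Num.sqrt (M * m) ^+ 2 = M * m by rewrite sqr_sqrtr// ltW// mulr_gt0.
move: h w0; set w := Num.sqrt _ => h w0 ww.
rewrite sqrrB exprMn ww; lra.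
Qed.

End PointwiseInequalities.

(** Since (sqrt M - sqrt m)^2 = M + m - 2 sqrt (M m), [rhs] is (K - 1) B^2, and squaring is faithful
    on nonnegative numbers: everything depends on the sign or vanishing of K B^2 - A^2. *)
Lemma sqr_diff_le_iff (R : realType) (M m A B : R) :
  let K := (M + m) / (2 * Num.sqrt (M * m)) in
  let rhs := (Num.sqrt M - Num.sqrt m) ^+ 2 / (2 * Num.sqrt (M * m)) * B ^+ 2 in
  0 < m -> 0 < M -> 0 <= A -> 0 <= B ->
  [/\ A ^+ 2 - B ^+ 2 <= rhs <-> A ^+ 2 <= K * B ^+ 2,
      A <= Num.sqrt K * B <-> A ^+ 2 <= K * B ^+ 2,
      A ^+ 2 - B ^+ 2 = rhs <-> K * B ^+ 2 - A ^+ 2 = 0 &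
      A = Num.sqrt K * B <-> K * B ^+ 2 - A ^+ 2 = 0].
Proof.
move=> K rhs m0 M0 A0 B0.
have w0 : 0 < Num.sqrt (M * m) by rewrite sqrtr_gt0 mulr_gt0.
have K0 : 0 <= K by rewrite divr_ge0 ?addr_ge0 ?mulr_ge0// ltW.
have -> : rhs = K * B ^+ 2 - B ^+ 2.
  rewrite /rhs sqrrB !sqr_sqrtr ?(ltW m0) ?(ltW M0)// -sqrtrM ?(ltW M0)// /K.
  by field; rewrite gt_eqF.
have KB : K * B ^+ 2 = (Num.sqrt K * B) ^+ 2 by rewrite exprMn sqr_sqrtr.
have KB0 : 0 <= Num.sqrt K * B by rewrite mulr_ge0// sqrtr_ge0.
split; first by split; lra.
- by rewrite KB ler_sqr.
- by split; lra.
- rewrite KB; split=> [->|/eqP]; first by rewrite subrr.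
  by rewrite subr_eq0 eqrXn2// => /eqP.
Qed.

(** * The inequality and its equality case *)

Theorem theorem4 (R : realType) (k : scalar_kind) (H : hilbertSpace R k)
    (a b : R) (f : R -> H) (M m : R)
    (le_ab : a <= b)
    (f_int : bochner_integrable (@lebesgue_measure R) `[a, b] f)
    (m_gt0 : 0 < m) (m_le1 : m <= 1) (M_ge1 : 1 <= M) :
  let ae_Delta (P : R -> R -> Prop) :=
    {ae (@lebesgue_measure R \x @lebesgue_measure R)%E,
      forall p : R * R, a <= p.1 /\ p.1 <= p.2 /\ p.2 <= b -> P p.1 p.2} in
  let condRe := ae_Delta (fun t s =>
    0 <= re_inner (of_real k M *: f s - f t) (f t - of_real k m *: f s)) in
  let condNorm := ae_Delta (fun t s =>
    rnorm (f t - of_real k ((M + m) / 2) *: f s)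
      <= 1 / 2 * (M - m) * rnorm (f s)) in
  let condEq := ae_Delta (fun t s =>
    rnorm (f t) * rnorm (f s)
      = (M + m) / (2 * Num.sqrt (M * m)) * re_inner (f t) (f s)) in
  let A : R := \int[@lebesgue_measure R]_(t in `[a, b]) rnorm (f t) in
  let B : R := rnorm (bochner_integral (@lebesgue_measure R) `[a, b] f) in
  let lhs1 := A ^+ 2 - B ^+ 2 in
  let rhs1 :=
    (Num.sqrt M - Num.sqrt m) ^+ 2 / (2 * Num.sqrt (M * m)) * B ^+ 2 in
  let rhs2 := Num.sqrt ((M + m) / (2 * Num.sqrt (M * m))) * B in
  [/\ condRe <-> condNorm,
      lhs1 <= rhs1 <-> A <= rhs2 &
      condRe \/ condNorm ->
        [/\ lhs1 <= rhs1,
            A <= rhs2,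
            lhs1 = rhs1 <-> condEq &
            A = rhs2 <-> condEq]].
Proof.
move=> ae_Delta condRe condNorm condEq A B lhs1 rhs1 rhs2.
have mM : m <= M := le_trans m_le1 M_ge1.
have M_gt0 : 0 < M := lt_le_trans m_gt0 mM.
have A0 : 0 <= A by apply: Rintegral_ge0 => t _; exact: rnorm_ge0.
have B0 : 0 <= B := rnorm_ge0 _.
have [le1 le2 eq1 eq2] := sqr_diff_le_iff m_gt0 M_gt0 A0 B0.
have condP : condRe <-> condNorm.
  by split; apply: ae_imply => p h /h; apply re_inner_ge0_iff_rdist_le.
split=> //; first by rewrite le1 le2.
move=> cond; have {cond}cRe : condRe by case: cond => // /condP.
set K := (M + m) / (2 * Num.sqrt (M * m)) in le1 le2 eq1 eq2.
have mab : measurable (`[a, b] : set (measurableTypeR R)) by exact: measurable_itv.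
have [N [mN N0 [iI1 iI2 EI1 EI2]]] := bochner_integral_product mab f_int.
set g := patch _ _ _ in iI1 iI2 EI1 EI2.
pose q t s := K * re_inner (f t) (f s) - rnorm (f t) * rnorm (f s).
pose qg (p : R * R) := K * re_inner (g p.1) (g p.2) - rnorm (g p.1) * rnorm (g p.2).
have qC t s : q t s = q s t by rewrite /q re_innerC [X in _ - X]mulrC.
pose mu := @lebesgue_measure R.
(* Transfer from [f] on the triangle to [g] on the whole plane. Where [g] vanishes at a coordinate,
   [qg] is 0, whence the condition [P 0]. It serves for nonnegativity and for vanishing. *)
have aeP (P : R -> Prop) : P 0 -> ae_Delta (fun t s => P (q t s)) <->
    {ae (mu \x mu)%E, forall p : R * R, P (qg p)}.
  move=> P0; apply: iff_trans.
    apply: (ae_triangle (Q := fun t s => P (q t s)) a b mN N0) => t s.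
    by rewrite qC.
  split; apply: ae_imply => -[t s] /=; rewrite /qg /g /patch/=; last first.
    by move=> + Et Es; rewrite !mem_set.
  case: ifPn => [/set_mem Et|_]; last by rewrite re_inner0l rnorm0 mulr0 mul0r subr0.
  case: ifPn => [/set_mem Es|_]; first exact.
  by rewrite re_inner0r rnorm0 !mulr0 subr0.
have qg0 : {ae (mu \x mu)%E, forall p, 0 <= qg p}.
  apply/(aeP (fun x => 0 <= x)) => //; apply: ae_imply cRe => p h /h.
  by rewrite subr_ge0; exact: rnorm_mul_le.
have iKI1 : (mu \x mu)%E.-integrable setT
    (EFin \o (fun p : R * R => K * re_inner (g p.1) (g p.2))).
  by apply: eq_integrable (integrableZl measurableT K iI1) => // p _; rewrite /= EFinM.
have iq : (mu \x mu)%E.-integrable setT (EFin \o qg).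
  by apply: eq_integrable (integrableB measurableT iKI1 iI2) => // p _.
(* Nonnegativity of this integral is the inequality, and its vanishing is the case of equality. *)
have Iq : \int[(mu \x mu)%E]_p qg p = K * B ^+ 2 - A ^+ 2.
  by rewrite /qg RintegralB// EI2 RintegralZl// EI1.
have [] := ae_ge0_integral iq qg0; rewrite Iq subr_ge0 => AB Iq0.
have eqP : condEq <-> K * B ^+ 2 - A ^+ 2 = 0.
  rewrite Iq0 -(aeP (fun x => x = 0))//.
  by split; apply: ae_imply => p h /h; rewrite /q => /eqP; rewrite ?subr_eq0;
    move=> /eqP h1; apply/eqP; rewrite ?subr_eq0 h1.
by split; [exact/le1|exact/le2|rewrite eq1 eqP|rewrite eq2 eqP].
Qed.
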